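(* For every permutation $\alpha\in\mathbb S_m$, the polynomial obtained from $w_{\mathfrak{gl}}(\alpha)\in\mathbb C[N,C_1,C_2,\dots]$ by the substitution $C_k:=N^{k-1}$ for all $k\ge1$ (equivalently, $F(\alpha)=T(w_{\mathfrak{gl}(N)}(\alpha))$ where $T(a)=\frac1N\operatorname{Tr}\operatorname{St}_N(a)$ for $a\in U\mathfrak{gl}(N)$) is the monomial $N^{f(\alpha)-1}$.
   Context: For a positive integer $N$, let $E_{ij}$ ($1\le i,j\le N$) be the matrix units of $\mathfrak{gl}(N)$ and $U\mathfrak{gl}(N)$ its universal enveloping algebra; $\operatorname{St}_N:U\mathfrak{gl}(N)\to\mathrm{Mat}_N(\mathbb C)$ is the standard representation. For $\alpha\in\mathbb S_m$ set $w_{\mathfrak{gl}(N)}(\alpha)=\sum_{i_1,\dots,i_m=1}^N E_{i_1i_{\alpha(1)}}E_{i_2i_{\alpha(2)}}\cdots E_{i_mi_{\alpha(m)}}\in U\mathfrak{gl}(N)$, and let $C_k^{(N)}=w_{\mathfrak{gl}(N)}((1,2,\dots,k))$ be the Casimir elements. The universal $\mathfrak{gl}$-weight system $w_{\mathfrak{gl}}(\alpha)$ is the (unique, by a theorem of Z. Yang it exists) polynomial in $\mathbb C[N,C_1,C_2,\dots]$ such that for every positive integer $N$, substituting this integer for $N$ and $C_k^{(N)}$ for $C_k$ gives $w_{\mathfrak{gl}(N)}(\alpha)$; in particular $w_{\mathfrak{gl}}$ of the empty permutation is $1$ and $w_{\mathfrak{gl}}((1,2,\dots,k))=C_k$. The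 number of faces $f(\alpha)$ of $\alpha\in\mathbb S_m$ is the number of cycles of the permutation $\alpha^{-1}\sigma^{-1}$, where $\sigma=(1,2,\dots,m)$ is the standard long cycle; by convention $f$ of the empty permutation is $1$.
   Formalization: The number of faces f(α) is taken as the number of cycles of α⁻¹σ instead of α⁻¹σ⁻¹; with the latter the claim fails, e.g. for α=(1,2,3), where w_gl(α)=C_3 becomes N² but α⁻¹σ⁻¹ has a single cycle. *)

(* Defs.v *)
From HB Require Import structures.
From mathcomp Require Import all_boot all_order all_fingroup all_algebra.
From mathcomp Require Import generic_quotient boolp reals complex.
From mathcomp Require Import finmap.
From mathcomp.multinomials Require Import monalg.

Set Implicit Arguments.
Unset Strict Implicit.
Unset Printing Implicit Defensive.

Import GRing.Theory.
Local Open Scope ring_scope.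
Local Open Scope quotient_scope.

Section FreeAlgebra.
Variables (K : fieldType) (I : choiceType).
Local Notation F := {malg K[{fmonom I}]}.

Definition freeX (x : I) : F := << (1 : K) *g fmu x >>.

Lemma freealg_scalerAr (c : K) (x y : F) : c *: (x * y) = x * (c *: y).
Proof.
rewrite [x * y]malgME.
rewrite (malgMEw (fsubset_refl (msupp x)) (msuppZ_le c y)).
rewrite scaler_sumr; apply: eq_bigr => k1 _.
rewrite scaler_sumr; apply: eq_bigr => k2 _.
apply/malgP => k; rewrite (mcoeffZ c y k2) mcoeffZ.
move: x@_k1 y@_k2 => a b.
by rewrite [RHS]mcoeffU mcoeffU mulrCA mulrnAr.
Qed.

Variables (A : algType K) (f : I -> A).

Definition word_eval (w : {fmonom I}) : A := \prod_(x <- w) f x.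

Fact word_eval_mmorphism : mmorphism word_eval.
Proof.
by split=> [v w|]; rewrite /word_eval ?fmM ?fm1 ?big_nil // big_cat.
Qed.

HB.instance Definition _ :=
  monalg.isMultiplicative.Build {fmonom I} A word_eval word_eval_mmorphism.

Definition free_eval : F -> A := mmap (in_alg A) word_eval.

Fact free_eval_zmod_morphism : zmod_morphism free_eval.
Proof. exact: raddfB. Qed.

HB.instance Definition _ :=
  GRing.isZmodMorphism.Build F A free_eval free_eval_zmod_morphism.

Fact free_eval_monoid_morphism : monoid_morphism free_eval.
Proof.
have comm_f (g : F) (v w : {fmonom I}) :
  GRing.comm (in_alg A g@_v) (word_eval w) by exact: comm_alg.
have [fM f1] := commr_mmap_is_multiplicative comm_f.
by split; [exact: f1 | exact: fM].
Qed.

HB.instance Definition _ :=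
  GRing.isMonoidMorphism.Build F A free_eval free_eval_monoid_morphism.

Fact free_eval_scalable : scalable free_eval.
Proof. by move=> c x; rewrite [LHS]mmapZ /= mulr_algl. Qed.

HB.instance Definition _ :=
  GRing.isScalable.Build K F A *:%R free_eval free_eval_scalable.

Lemma free_evalX x : free_eval (freeX x) = f x.
Proof.
by rewrite [LHS]mmapU /= scale1r mul1r /word_eval fmU big_seq1.
Qed.

End FreeAlgebra.

(* The universal enveloping algebra of gl(N): the free associative algebra on
   letters E_ij modulo the two-sided ideal generated by
   E_ij E_kl - E_kl E_ij - [E_ij, E_kl]. *)
Section Ugl.
Variables (K : fieldType) (N : nat).

Local Notation gl_letter := ('I_N * 'I_N)%type.

Local Notation F := {malg K[{fmonom gl_letter}]}.

Definition gl_relator (p : gl_letter * gl_letter) : F :=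
  let: ((i, j), (k, l)) := p in
  freeX K (i, j) * freeX K (k, l) - freeX K (k, l) * freeX K (i, j)
    - ((j == k)%:R *: freeX K (i, l) - (l == i)%:R *: freeX K (k, j)).

Definition gl_ideal (x : F) : Prop :=
  exists s : seq (F * (gl_letter * gl_letter) * F),
    x = \sum_(t <- s) t.1.1 * gl_relator t.1.2 * t.2.

Lemma gl_ideal0 : gl_ideal 0.
Proof. by exists [::]; rewrite big_nil. Qed.

Lemma gl_idealD x y : gl_ideal x -> gl_ideal y -> gl_ideal (x + y).
Proof. by move=> [s ->] [t ->]; exists (s ++ t); rewrite big_cat. Qed.

Lemma gl_idealMl x y : gl_ideal y -> gl_ideal (x * y).
Proof.
move=> [s ->]; exists [seq (x * t.1.1, t.1.2, t.2) | t <- s].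
rewrite big_map mulr_sumr; apply: eq_bigr => t _.
by rewrite mulrA mulrA.
Qed.

Lemma gl_idealMr x y : gl_ideal y -> gl_ideal (y * x).
Proof.
move=> [s ->]; exists [seq (t.1.1, t.1.2, t.2 * x) | t <- s].
rewrite big_map mulr_suml; apply: eq_bigr => t _.
exact: esym (mulrA _ _ _).
Qed.

Lemma gl_idealN x : gl_ideal x -> gl_ideal (- x).
Proof. by rewrite -mulN1r; exact: gl_idealMl. Qed.

Lemma gl_idealB x y : gl_ideal x -> gl_ideal y -> gl_ideal (x - y).
Proof. by move=> Ix /gl_idealN; exact: gl_idealD. Qed.

Lemma gl_ideal_rel p : gl_ideal (gl_relator p).
Proof. by exists [:: (1, p, 1)]; rewrite big_seq1 mul1r mulr1. Qed.

Definition ugl_eqv (x y : F) : bool := `[< gl_ideal (x - y) >].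

Lemma ugl_eqv_refl : reflexive ugl_eqv.
Proof. by move=> x; apply/asboolP; rewrite subrr; exact: gl_ideal0. Qed.

Lemma ugl_eqv_sym : symmetric ugl_eqv.
Proof.
by move=> x y; apply/asboolP/asboolP => /gl_idealN; rewrite opprB.
Qed.

Lemma ugl_eqv_trans : transitive ugl_eqv.
Proof.
move=> y x z /asboolP Ixy /asboolP Iyz; apply/asboolP.
by have := gl_idealD Ixy Iyz; rewrite addrA subrK.
Qed.

Canonical ugl_equiv :=
  EquivRel ugl_eqv ugl_eqv_refl ugl_eqv_sym ugl_eqv_trans.

Definition ugl : Type := {eq_quot ugl_equiv}.
HB.instance Definition _ := Choice.on ugl.
HB.instance Definition _ := EqQuotient.on ugl.

Definition ugl_pi (x : F) : ugl := \pi_ugl x.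

Lemma ugl_piP x y : ugl_pi x = ugl_pi y <-> gl_ideal (x - y).
Proof.
have E : (ugl_pi x == ugl_pi y) = ugl_eqv x y by exact: eqmodE.
by split=> [/eqP|/asboolP Ixy]; [rewrite E => /asboolP | apply/eqP; rewrite E].
Qed.

Lemma ugl_reprK : cancel (fun u : ugl => repr u) ugl_pi.
Proof. exact: reprK. Qed.

Lemma ugl_repr_pi x : gl_ideal (repr (ugl_pi x) - x).
Proof. by apply/ugl_piP; rewrite ugl_reprK. Qed.

Definition ugl_add (u v : ugl) := ugl_pi (repr u + repr v).
Definition ugl_opp (u : ugl) := ugl_pi (- repr u).
Definition ugl_mul (u v : ugl) := ugl_pi (repr u * repr v).
Definition ugl_scale (c : K) (u : ugl) := ugl_pi (c *: repr u).

Lemma ugl_piD x y : ugl_add (ugl_pi x) (ugl_pi y) = ugl_pi (x + y).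
Proof.
by apply/ugl_piP; rewrite opprD addrACA; apply: gl_idealD; exact: ugl_repr_pi.
Qed.

Lemma ugl_piN x : ugl_opp (ugl_pi x) = ugl_pi (- x).
Proof. by apply/ugl_piP; rewrite -opprD; exact/gl_idealN/ugl_repr_pi. Qed.

Lemma ugl_piM x y : ugl_mul (ugl_pi x) (ugl_pi y) = ugl_pi (x * y).
Proof.
apply/ugl_piP; set x' := repr _; set y' := repr _.
have -> : x' * y' - x * y = x' * (y' - y) + (x' - x) * y.
  by rewrite mulrBr mulrBl addrA subrK.
by apply: gl_idealD; [apply: gl_idealMl | apply: gl_idealMr];
  exact: ugl_repr_pi.
Qed.

Lemma ugl_piZ c x : ugl_scale c (ugl_pi x) = ugl_pi (c *: x).
Proof.
apply/ugl_piP; rewrite -scalerBr -[_ - x]mul1r scalerAl.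
by apply: gl_idealMl; exact: ugl_repr_pi.
Qed.

Let pi_ind (P : ugl -> Prop) : (forall x, P (ugl_pi x)) -> forall u, P u.
Proof. by move=> Ppi u; rewrite -[u]ugl_reprK. Qed.

Fact ugl_addA : associative ugl_add.
Proof. by do 3!elim/pi_ind=> ?; rewrite !ugl_piD addrA. Qed.
Fact ugl_addC : commutative ugl_add.
Proof. by do 2!elim/pi_ind=> ?; rewrite !ugl_piD addrC. Qed.
Fact ugl_add0 : left_id (ugl_pi 0) ugl_add.
Proof. by elim/pi_ind=> ?; rewrite !ugl_piD add0r. Qed.
Fact ugl_addN : left_inverse (ugl_pi 0) ugl_opp ugl_add.
Proof. by elim/pi_ind=> ?; rewrite ugl_piN ugl_piD addNr. Qed.

HB.instance Definition _ :=
  GRing.isZmodule.Build ugl ugl_addA ugl_addC ugl_add0 ugl_addN.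

Fact ugl_mulA : associative ugl_mul.
Proof. by do 3!elim/pi_ind=> ?; rewrite !ugl_piM mulrA. Qed.
Fact ugl_mul1l : left_id (ugl_pi 1) ugl_mul.
Proof. by elim/pi_ind=> ?; rewrite ugl_piM mul1r. Qed.
Fact ugl_mul1r : right_id (ugl_pi 1) ugl_mul.
Proof. by elim/pi_ind=> ?; rewrite ugl_piM mulr1. Qed.
Fact ugl_mulDl : left_distributive ugl_mul ugl_add.
Proof. by do 3!elim/pi_ind=> ?; rewrite !(ugl_piD, ugl_piM) mulrDl. Qed.
Fact ugl_mulDr : right_distributive ugl_mul ugl_add.
Proof. by do 3!elim/pi_ind=> ?; rewrite !(ugl_piD, ugl_piM) mulrDr. Qed.

Fact gl_ideal_eval (A : algType K) (f : gl_letter -> A) :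
  (forall i j k l, f (i, j) * f (k, l) - f (k, l) * f (i, j)
     = (j == k)%:R *: f (i, l) - (l == i)%:R *: f (k, j)) ->
  forall x, gl_ideal x -> free_eval f x = 0.
Proof.
move=> fP x [s ->].
have evM y z : free_eval f (y * z) = free_eval f y * free_eval f z.
  exact: rmorphM.
have evB y z : free_eval f (y - z) = free_eval f y - free_eval f z.
  exact: raddfB.
have evZ c y : free_eval f (c *: y) = c *: free_eval f y by exact: linearZ.
rewrite [LHS](raddf_sum (free_eval f)) big1 //= => -[[a [[i j] [k l]]] b] _.
rewrite evM evM /fst /snd; suff -> : free_eval f (gl_relator ((i, j), (k, l))) = 0.
  by rewrite mulr0 mul0r.
have evR a1 a2 a3 a4 c d :
    free_eval f (a1 * a2 - a2 * a1 - (c *: a3 - d *: a4))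
    = free_eval f a1 * free_eval f a2 - free_eval f a2 * free_eval f a1
      - (c *: free_eval f a3 - d *: free_eval f a4).
  rewrite [LHS]evB; congr (_ - _); rewrite [LHS]evB; congr (_ - _).
  - exact: evM.
  - exact: evM.
  - exact: evZ.
  - exact: evZ.
by rewrite [LHS]evR !free_evalX fP subrr.
Qed.

Fact ugl_oner_neq0 : ugl_pi 1 != ugl_pi 0.
Proof.
apply/eqP => /ugl_piP; rewrite subr0.
move=> /(@gl_ideal_eval K^o (fun=> 0)) h; have := oner_neq0 K.
have /eqP : free_eval (fun=> 0 : K^o) (1 : F) = 0.
  by apply: h => *; rewrite !scaler0 mulr0.
by rewrite rmorph1 => ->.
Qed.

HB.instance Definition _ := GRing.Zmodule_isNzRing.Build ugl
  ugl_mulA ugl_mul1l ugl_mul1r ugl_mulDl ugl_mulDr ugl_oner_neq0.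

Fact ugl_scaleA a b u : ugl_scale a (ugl_scale b u) = ugl_scale (a * b) u.
Proof. by elim/pi_ind: u => x; rewrite !ugl_piZ scalerA. Qed.
Fact ugl_scale1 : left_id 1 ugl_scale.
Proof. by elim/pi_ind=> x; rewrite ugl_piZ scale1r. Qed.
Fact ugl_scaleDr : right_distributive ugl_scale +%R.
Proof.
by move=> c; do 2!elim/pi_ind=> ?; rewrite /GRing.add /= !(ugl_piD, ugl_piZ) scalerDr.
Qed.
Fact ugl_scaleDl u : {morph ugl_scale^~ u : a b / a + b}.
Proof.
elim/pi_ind: u => x a b; rewrite ugl_piZ scalerDl -ugl_piD.
by rewrite (ugl_piZ a) (ugl_piZ b).
Qed.

HB.instance Definition _ := GRing.Zmodule_isLmodule.Build K ugl
  ugl_scaleA ugl_scale1 ugl_scaleDr ugl_scaleDl.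

Fact ugl_scalerAl (c : K) (u v : ugl) : c *: (u * v) = (c *: u) * v.
Proof.
elim/pi_ind: u => x; elim/pi_ind: v => y.
by rewrite [LHS](congr1 _ (ugl_piM x y)) [LHS]ugl_piZ
   [_ *: ugl_pi x]ugl_piZ [RHS]ugl_piM scalerAl.
Qed.
HB.instance Definition _ := GRing.Lmodule_isLalgebra.Build K ugl ugl_scalerAl.

Fact ugl_scalerAr (c : K) (u v : ugl) : c *: (u * v) = u * (c *: v).
Proof.
elim/pi_ind: u => x; elim/pi_ind: v => y.
by rewrite [LHS](congr1 _ (ugl_piM x y)) [LHS]ugl_piZ
   [_ *: ugl_pi y]ugl_piZ [RHS]ugl_piM freealg_scalerAr.
Qed.
HB.instance Definition _ := GRing.Lalgebra_isAlgebra.Build K ugl ugl_scalerAr.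

Definition uglE (i j : 'I_N) : ugl := ugl_pi (freeX K (i, j)).

Lemma ugl_bracket i j k l : uglE i j * uglE k l - uglE k l * uglE i j
  = (j == k)%:R *: uglE i l - (l == i)%:R *: uglE k j.
Proof.
have piB x y : ugl_pi x - ugl_pi y = ugl_pi (x - y).
  by rewrite [- _]ugl_piN [LHS]ugl_piD.
rewrite [_ * _]ugl_piM [uglE k l * _]ugl_piM.
rewrite [_ *: uglE i l]ugl_piZ [_ *: uglE k j]ugl_piZ !piB.
by apply/ugl_piP; exact: (gl_ideal_rel ((i, j), (k, l))).
Qed.

Definition ugl_lift (A : algType K) (f : gl_letter -> A) (u : ugl) : A :=
  free_eval f (repr u).

Lemma ugl_lift_pi (A : algType K) (f : gl_letter -> A) :
  (forall i j k l, f (i, j) * f (k, l) - f (k, l) * f (i, j)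
     = (j == k)%:R *: f (i, l) - (l == i)%:R *: f (k, j)) ->
  forall x, ugl_lift f (ugl_pi x) = free_eval f x.
Proof.
move=> fP x; apply/eqP; rewrite -subr_eq0 /ugl_lift; apply/eqP.
have <- : free_eval f (repr (ugl_pi x) - x)
    = free_eval f (repr (ugl_pi x)) - free_eval f x by exact: raddfB.
exact/(gl_ideal_eval fP)/ugl_repr_pi.
Qed.

End Ugl.

Section StandardRepresentation.
Variables (K : fieldType) (n : nat).
Local Notation N := n.+1.
Local Notation U := (ugl K N).

Definition St : U -> 'M[K]_N :=
  ugl_lift (fun p : 'I_N * 'I_N => delta_mx p.1 p.2 : 'M[K]_N).

Lemma St_pi x : St (ugl_pi x) =
  free_eval (fun p : 'I_N * 'I_N => delta_mx p.1 p.2 : 'M[K]_N) x.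
Proof.
apply: ugl_lift_pi => i j k l; by rewrite -!mulmxE !mul_delta_mx_cond !scaler_nat.
Qed.

Fact St_zmod_morphism : zmod_morphism St.
Proof.
move=> u v; rewrite -[u]ugl_reprK -[v]ugl_reprK.
rewrite [- ugl_pi _]ugl_piN [_ + _]ugl_piD !St_pi; exact: raddfB.
Qed.

Fact St_monoid_morphism : monoid_morphism St.
Proof.
split=> [|u v]; first by rewrite [1]/(ugl_pi 1) St_pi; exact: rmorph1.
rewrite -[u]ugl_reprK -[v]ugl_reprK.
rewrite [_ * _]ugl_piM !St_pi; exact: rmorphM.
Qed.

Fact St_scalable : scalable St.
Proof.
by move=> c u; rewrite -[u]ugl_reprK [_ *: _]ugl_piZ !St_pi; exact: linearZ.
Qed.

HB.instance Definition _ :=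
  GRing.isZmodMorphism.Build U 'M[K]_N St St_zmod_morphism.
HB.instance Definition _ :=
  GRing.isMonoidMorphism.Build U 'M[K]_N St St_monoid_morphism.
HB.instance Definition _ :=
  GRing.isScalable.Build K U 'M[K]_N *:%R St St_scalable.

Lemma St_E i j : St (uglE K i j) = delta_mx i j.
Proof. by rewrite St_pi free_evalX. Qed.

Definition normalized_trace (a : U) : K := N%:R^-1 * \tr (St a).

End StandardRepresentation.

Definition long_cycle (m : nat) : 'S_m := perm (@ordS_inj m).

Definition w_glN (K : fieldType) (N m : nat) (alpha : 'S_m) : ugl K N :=
  \sum_(i : {ffun 'I_m -> 'I_N}) \prod_(k < m) uglE K (i k) (i (alpha k)).

Definition casimir (K : fieldType) (N k : nat) : ugl K N :=
  w_glN K N (long_cycle k).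

(* K[N, C_1, C_2, ...]: the variable of index 0 is N, that of index k > 0
   is C_k. *)
Definition glpoly (K : fieldType) := {malg K[{cmonom nat}]}.

(* The image of P when N is replaced by xN and C_k by xC k.  In a
   noncommutative A this is meaningful when these elements commute, as the
   Casimir elements do, since each monomial is evaluated with its variables
   in some fixed order.  The value of xC at 0 is irrelevant. *)
Definition glpoly_subst (K : fieldType) (A : algType K) (xN : A)
    (xC : nat -> A) (P : glpoly K) : A :=
  mmap (in_alg A)
    (fun mon : {cmonom nat} =>
       \prod_(k <- finsupp mon) (if k is 0 then xN else xC k) ^+ mon k) P.

Definition is_universal_gl_weight (K : fieldType) (m : nat) (alpha : 'S_m)
    (P : glpoly K) : Prop :=
  forall N : nat, (0 < N)%N ->
    glpoly_subst (N%:R : ugl K N) (casimir K N) P = w_glN K N alpha.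

(* [porbits] counts fixed points as cycles.  The permutation is
   alpha^-1 sigma, not alpha^-1 sigma^-1: the two have equally many cycles when
   alpha is an involution, but for alpha = sigma = (1 2 ... m), m > 2, only the
   first gives the m faces required by C_m |-> N^(m-1). *)
Definition faces (m : nat) (alpha : 'S_m) : nat :=
  if m == 0%N then 1%N else #|porbits (alpha^-1 * long_cycle m)%g|.

(* Main.v *)
Require Import Defs.
From mathcomp Require Import all_boot all_order all_fingroup all_algebra.
From mathcomp Require Import reals complex.
From mathcomp.multinomials Require Import monalg.
Import GRing.Theory.
Local Open Scope ring_scope.

(** In the standard representation, a product of matrix units is nonzero only
    if consecutive indices match, so the trace of [w_glN alpha] counts the
    index assignments [i] with [i \o alpha = i \o sigma], that is, those that
    are constant on the cycles of [alpha^-1 * sigma]: there are [N ^ faces] of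
    them.  The Casimir element [C_k] acts as the scalar [N ^ (k - 1)], so the
    substitution [C_k := N ^ (k - 1)] computes the action of [w_glN alpha] for
    every integer [N], and two polynomials that agree on all positive integers
    are equal. *)

(** An invariant function is constant on each cycle, so it factors uniquely through the set of
    cycles: [lift] is a bijection onto the invariant functions. *)
Lemma card_ffun_perm_invariant (T S : finType) (s : {perm T}) :
  #|[set f : {ffun T -> S} | [forall x, f (s x) == f x]]|
    = (#|S| ^ #|porbits s|)%N.
Proof.
pose orb := {B | B \in porbits s}.
have porbitsP x : porbit s x \in porbits s by apply: imset_f.
pose cls x : orb := Sub (porbit s x) (porbitsP x).
pose lift (g : {ffun orb -> S}) : {ffun T -> S} := [ffun x => g (cls x)].
have lift_inj : injective lift.
  move=> g h /ffunP eq_gh; apply/ffunP => -[B PB].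
  have /imsetP[x _ defB] := PB.
  have -> : exist _ B PB = cls x by apply: val_inj.
  by have := eq_gh x; rewrite !ffunE.
have -> : [set f : {ffun T -> S} | [forall x, f (s x) == f x]]
    = [set lift g | g in {: {ffun orb -> S}}].
  apply/setP => f; rewrite inE; apply/forallP/imsetP => [fs | [g _ ->] x].
    have fX i x : f ((s ^+ i)%g x) = f x.
      elim: i => [|i IHi]; first by rewrite expg0 perm1.
      by rewrite expgSr permM (eqP (fs _)).
    have fcls x y : porbit s x = porbit s y -> f x = f y.
      move/eqP; rewrite eq_porbit_mem => /porbitP[i ->]; exact: fX.
    have /fin_all_exists[g gP] (B : orb) :
        exists z, forall x, porbit s x = val B -> f x = z.
      case: B => B /= /imsetP[y _ ->]; exists (f y) => x; exact: fcls.
    exists (finfun g) => //; apply/ffunP => x.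
    by rewrite !ffunE (gP (cls x)).
  rewrite !ffunE; apply/eqP; congr (g _); apply: val_inj.
  exact: (porbit_perm s 1).
rewrite card_imset // card_ffun card_sig; congr (_ ^ _)%N.
Qed.

Lemma long_cycle_inord (m k : nat) :
  (k < m)%N -> long_cycle m.+1 (inord k) = inord k.+1.
Proof.
move=> lt_km; apply: val_inj; rewrite permE /= !inordK ?ltnS //; last exact: ltnW.
by rewrite modn_small.
Qed.

Lemma long_cycle_max (m : nat) : long_cycle m.+1 ord_max = ord0.
Proof. by apply: val_inj; rewrite permE /= modnn. Qed.

(** Makes [(faces alpha).-1] a genuine subtraction when the trace is divided by $N$. *)
Lemma faces_gt0 (m : nat) (alpha : 'S_m) : (0 < faces alpha)%N.
Proof.
rewrite /faces; case: eqP => // /eqP; rewrite -lt0n => m_gt0.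
by apply/card_gt0P; eexists; apply: (imset_f _ (x := Ordinal m_gt0)).
Qed.

Section MatrixUnits.
Variables (K : fieldType) (n : nat).

(** Iterates $E_{ab}E_{cd}=[b=c]E_{ad}$; indexing by [nat] keeps the induction free of ordinal
    casts. *)
Lemma prod_delta_mx (a b : nat -> 'I_n.+1) (m : nat) :
  \prod_(k < m.+1) (delta_mx (a k) (b k) : 'M[K]_n.+1)
    = (\prod_(k < m) (b k == a k.+1)%:R) *: delta_mx (a 0%N) (b m).
Proof.
elim: m => [|m IHm]; first by rewrite big_ord1 big_ord0 scale1r.
rewrite big_ord_recr /= IHm [in RHS]big_ord_recr /=.
rewrite -scalerAl -mulmxE mul_delta_mx_cond.
by rewrite -scaler_nat scalerA.
Qed.

Lemma mxtrace_delta (i j : 'I_n.+1) :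
  \tr (delta_mx i j : 'M[K]_n.+1) = (i == j)%:R.
Proof.
rewrite /mxtrace (bigD1 i) //= big1 => [|k nki].
  by rewrite addr0 mxE eqxx.
by rewrite mxE (negPf nki).
Qed.

Lemma St_w_glN (m : nat) (alpha : 'S_m) :
  St (w_glN K n.+1 alpha)
    = \sum_(i : {ffun 'I_m -> 'I_n.+1})
        \prod_(k < m) delta_mx (i k) (i (alpha k)).
Proof.
rewrite raddf_sum; apply: eq_bigr => i _.
rewrite /= rmorph_prod; apply: eq_bigr => k _; exact: St_E.
Qed.

Lemma prod_delta_ord (m : nat) (alpha : 'S_m.+1) (i : 'I_m.+1 -> 'I_n.+1) :
  \prod_(k < m.+1) (delta_mx (i k) (i (alpha k)) : 'M[K]_n.+1)
    = (\prod_(k < m) (i (alpha (inord k)) == i (inord k.+1))%:R)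
        *: delta_mx (i ord0) (i (alpha ord_max)).
Proof.
have := prod_delta_mx (fun k => i (inord k)) (fun k => i (alpha (inord k))) m.
have -> : inord 0 = ord0 :> 'I_m.+1 by apply: val_inj; rewrite /= inordK.
have -> : inord m = ord_max :> 'I_m.+1 by apply: val_inj; rewrite /= inordK.
by move=> <-; apply: eq_bigr => k _; rewrite inord_val.
Qed.

Lemma natr_forall (T : finType) (p : pred T) :
  [forall x, p x]%:R = \prod_x (p x)%:R :> K.
Proof.
have [/forallP p_all | /forallPn[x npx]] := boolP [forall x, p x].
  by rewrite big1 // => x _; rewrite p_all.
by rewrite (bigD1 x) //= (negPf npx) mul0r.
Qed.

(** The product imposes the matching conditions at all positions but the last; the trace adds the
    last one, where the long cycle returns to [ord0]. *)
Lemma mxtrace_prod_delta (m : nat) (alpha : 'S_m.+1) (i : 'I_m.+1 -> 'I_n.+1) :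
  \tr (\prod_(k < m.+1) (delta_mx (i k) (i (alpha k)) : 'M[K]_n.+1))
    = [forall k, i (alpha k) == i (long_cycle m.+1 k)]%:R.
Proof.
rewrite prod_delta_ord mxtraceZ mxtrace_delta.
rewrite natr_forall [RHS]big_ord_recr /= long_cycle_max [i ord0 == _]eq_sym.
congr (_ * _); apply: eq_bigr => k _.
rewrite -long_cycle_inord //; congr (i (alpha _) == i (long_cycle _ _))%:R;
  by apply: val_inj; rewrite /= inordK // ltnS ltnW.
Qed.

Lemma mxtrace_St_w_glN (m : nat) (alpha : 'S_m.+1) :
  \tr (St (w_glN K n.+1 alpha)) = n.+1%:R ^+ faces alpha.
Proof.
rewrite St_w_glN raddf_sum /=.
under eq_bigr do rewrite mxtrace_prod_delta.
rewrite -natr_sum -natrX /faces /=; congr _%:R.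
rewrite -[X in (X ^ _)%N](card_ord n.+1) -card_ffun_perm_invariant.
rewrite -sum1_card [RHS]big_mkcond; apply: eq_bigr => i _; rewrite inE.
(* Replace [k] by [alpha^-1 k]; in a product of permutations the left factor acts first. *)
suff -> : [forall k, i (alpha k) == i (long_cycle m.+1 k)]
   = [forall k, i ((alpha^-1 * long_cycle m.+1)%g k) == i k] by case: ifP.
apply/forallP/forallP => h k.
  by rewrite permM eq_sym; have := h (alpha^-1%g k); rewrite permKV.
by have := h (alpha k); rewrite permM permK eq_sym.
Qed.

(** For the long cycle all inner matching conditions hold trivially, so each [i] contributes the
    diagonal unit at [i ord0], and the other [k] indices are free. *)
Lemma St_casimir (k : nat) : St (casimir K n.+1 k.+1) = (n.+1%:R ^+ k)%:A.
Proof.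
rewrite St_w_glN.
under eq_bigr => i _.
  rewrite prod_delta_ord long_cycle_max big1 => [|j _]; last first.
    by rewrite long_cycle_inord ?eqxx.
  rewrite scale1r; over.
apply/matrixP => x y; rewrite summxE !mxE.
under eq_bigr do rewrite mxE.
have [<-{y} | neq_xy] := eqVneq x y; last first.
  rewrite mulr0 big1 // => i _; case: eqP => //= <-.
  by rewrite eq_sym (negPf neq_xy).
(* The indicator of [i ord0 == x] is spread over all coordinates so that the sum over [i] factors:
   coordinate [ord0] gives 1, each other one gives $N$. *)
transitivity (\sum_(i : {ffun 'I_k.+1 -> 'I_n.+1})
   \prod_j ((j == ord0) ==> (i j == x))%:R : K).
  apply: eq_bigr => i _; rewrite andbb big_ord_recl /= big1 ?mulr1 //.
  by rewrite eq_sym.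
rewrite -(bigA_distr_bigA
  (fun (j : 'I_k.+1) z => ((j == ord0) ==> (z == x))%:R : K)).
rewrite mulr1 big_ord_recl (bigD1 x) //= eqxx big1 ?addr0 ?mul1r => [|z /negPf-> //].
under eq_bigr => j _ do rewrite sumr_const card_ord.
by rewrite prodr_const card_ord.
Qed.

End MatrixUnits.

Lemma glpoly_subst_morph (K : fieldType) (A B : algType K)
    (phi : {rmorphism A -> B}) (xN : A) (xC : nat -> A) (yN : B)
    (yC : nat -> B) (P : glpoly K) :
    (forall c : K, phi c%:A = c%:A) -> phi xN = yN ->
    (forall k, phi (xC k.+1) = yC k.+1) ->
  phi (glpoly_subst xN xC P) = glpoly_subst yN yC P.
Proof.
move=> phiA phiN phiC; rewrite /glpoly_subst !mmapE rmorph_sum.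
apply: eq_bigr => mon _; rewrite rmorphM /= phiA; congr (_ * _).
rewrite rmorph_prod; apply: eq_bigr => -[|k] _.
  by rewrite rmorphXn /= phiN.
by rewrite rmorphXn /= phiC.
Qed.

Lemma horner_alg_scalar (K : fieldType) (A : algType K) (c : K)
    (p : {poly K}) :
  horner_alg (c%:A : A) p = p.[c]%:A.
Proof. exact: (horner_map (in_alg A)). Qed.

Section Substitution.
Variables (K : fieldType) (m : nat) (alpha : 'S_m) (P : glpoly K).
Hypothesis univP : is_universal_gl_weight alpha P.

(** Both sides equal [P] evaluated at the matrices $N\cdot I$ and $(N\cdot I)^{k-1}$: one through
    [horner_alg], the other through [St] applied to the universal identity. *)
Lemma horner_glpoly_subst (n : nat) :
  ((glpoly_subst ('X : {poly K}) (fun k => 'X^(k.-1)) P).[n.+1%:R])%:A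
    = St (w_glN K n.+1 alpha) :> 'M[K]_n.+1.
Proof.
rewrite -univP // -horner_alg_scalar.
set Nm : 'M_n.+1 := _%:A.
rewrite (@glpoly_subst_morph _ _ _ (horner_alg Nm) _ _ Nm (fun k => Nm ^+ k.-1)).
- symmetry; apply: glpoly_subst_morph => [c||k].
  + by rewrite /= linearZ /= rmorph1.
  + by rewrite rmorph_nat /Nm scaler_nat.
  + by rewrite /= St_casimir /Nm -in_algE rmorphXn.
- by move=> c; rewrite /= alg_polyC horner_algC.
- exact: horner_algX.
- by move=> k; rewrite rmorphXn /= horner_algX.
Qed.

End Substitution.

Lemma eq_poly_on_positive_nat (F : numDomainType) (p q : {poly F}) :
  (forall n : nat, p.[n.+1%:R] = q.[n.+1%:R]) -> p = q.
Proof.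
move=> eq_pq; apply/eqP; rewrite -subr_eq0; apply/eqP.
(* A nonzero polynomial has fewer roots than its size; these are distinct in characteristic 0. *)
apply: (@roots_geq_poly_eq0 _ _ [seq i.+1%:R | i <- iota 0 (size (p - q))]).
- by apply/allP => _ /mapP[i _ ->]; rewrite rootE !hornerE eq_pq subrr.
- rewrite map_inj_uniq ?iota_uniq // => i j /eqP.
  by rewrite Num.Theory.eqr_nat => /eqP[].
- by rewrite size_map size_iota.
Qed.

Lemma normalized_trace_w_glN (K : numFieldType) (m n : nat) (alpha : 'S_m) :
  normalized_trace (w_glN K n.+1 alpha) = n.+1%:R ^+ (faces alpha).-1.
Proof.
have nz : n.+1%:R != 0 :> K by rewrite Num.Theory.pnatr_eq0.
rewrite /normalized_trace; case: m alpha => [|m] alpha; last first.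
  by rewrite mxtrace_St_w_glN -[faces alpha in LHS](prednK (faces_gt0 _ _)) exprS mulKf.
(* For [m = 0] the only term is the empty product, the identity matrix, and [faces] is 1 by
   convention. *)
rewrite St_w_glN /faces /=.
under eq_bigr do rewrite big_ord0.
by rewrite sumr_const card_ffun !card_ord mxtrace1 mulVf.
Qed.

Theorem mainTheorem2 (R : realType) (m : nat) (alpha : 'S_m) :
  (forall P : glpoly R[i], is_universal_gl_weight alpha P ->
     glpoly_subst ('X : {poly R[i]}) (fun k => 'X^(k.-1)) P
       = 'X^((faces alpha).-1))
  /\
  (forall n : nat,
     normalized_trace (w_glN R[i] n.+1 alpha)
       = n.+1%:R ^+ (faces alpha).-1).
Proof.
split=> [P univP | n]; last exact: normalized_trace_w_glN.
apply: eq_poly_on_positive_nat => n.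
(* [St] of the weight is a scalar matrix here, so its normalized trace is the value of the
   substituted polynomial at $N$. *)
rewrite hornerXn -normalized_trace_w_glN /normalized_trace.
rewrite -(horner_glpoly_subst _ _ _ _ univP) mxtraceZ mxtrace1.
by rewrite mulrC mulfK // Num.Theory.pnatr_eq0.
Qed.
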